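(* Let $p$ be a prime and $m\geq 3$ an integer with $\gcd(p,m)=1$ and $\gcd(p-1,m)=1$. Let $\ell=\min\{e\geq 1:\gcd(p^e-1,m)>1\}$, $m'=\gcd(p^\ell-1,m)$ and $d'=(p^\ell-1)/m'$. Let $K=\mathbb{F}_{p^k}$ be a finite field containing all $m$th roots of unity and $d=(p^k-1)/m$. Then every integer $n\geq d'$ lies in $W_p(m')$ and every integer $n\geq d$ lies in $W_p(m)$, except in the following two special cases: (A) $d'=p-1$; (B) $p=2$, $d'=3$ and $m'=5$. In these special cases, every integer $n\geq d'+1$ lies in $W_p(m')$ and every integer $n\geq d+1$ lies in $W_p(m)$.
   Context: For a prime $p$ and a positive integer $m$, $W_p(m)$ denotes the set of integers $n\geq 0$ for which there exist $\alpha_1,\dots,\alpha_n\in\overline{\mathbb{F}}_p$ with $\alpha_i^m=1$ for all $i$ (repetitions allowed) and $\alpha_1+\cdots+\alpha_n=0$. *)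

(* Defs.v *)
From mathcomp Require Import all_boot all_order all_algebra all_field.

Set Implicit Arguments.
Unset Strict Implicit.
Unset Printing Implicit Defensive.

Import GRing.Theory.
Local Open Scope ring_scope.

(* [F] is an algebraic closure of the prime field of order [p] (for [p] prime,
   ['F_p] is the field with [p] elements). *)
Definition algebraic_closure_of_Fp (p : nat) (F : closedFieldType)
    (iota : {rmorphism 'F_p -> F}) : Prop :=
  integralRange iota.

(* [n \in W_p(m)], where [F] plays the role of the algebraic closure of ['F_p]. *)
Definition in_W (F : fieldType) (m n : nat) : Prop :=
  exists alpha : 'I_n -> F,
    (forall i, alpha i ^+ m = 1) /\ \sum_(i < n) alpha i = 0.

Definition is_minimum (P : nat -> Prop) (l : nat) : Prop :=
  P l /\ forall e : nat, P e -> (l <= e)%N.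

(* Main.v *)
Require Import Defs.
From mathcomp Require Import all_boot all_order all_algebra all_field cyclic ring.

(** Work inside [K], let [H] be the group of [M]-th roots of unity with
    [M = m'], [L] the subfield with [p ^ l] elements and [S_n] the [n]-fold
    sumset of [H].  By minimality of [l] every element of [H] other than 1
    has degree [l] over the prime field, so a nonempty [H]-stable subset of [L]
    that is stable under a nonzero translation contains [L].  It follows that
    the number of [H]-cosets in [S_n] increases with [n] until [S_n] contains
    all nonzero elements of [L]; there are [d'] such cosets, whence [S_n]
    contains 0 for [n > d'].  If [S_2] has three nonzero cosets, one step is
    gained and [n = d'] is also reached.  If it has only two, the Frobenius
    map produces an element of [S_2] in the prime field ([p] odd), respectively
    1 or a primitive cube root of unity ([p = 2]), from which 0 is written down
    explicitly.  Finally [d' * m = lcm (p ^ l - 1, m)] divides [p ^ k - 1], so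
    [d' <= d]. *)

Set Implicit Arguments.
Unset Strict Implicit.
Unset Printing Implicit Defensive.

Import GRing.Theory.
Local Open Scope ring_scope.

(** * Arithmetic of exponents and elements of the prime field *)

Lemma modn_expnB1 (p M l k : nat) :
  (0 < p)%N -> (M %| p ^ l - 1)%N ->
  (M %| p ^ k - 1)%N = (M %| p ^ (k %% l) - 1)%N.
Proof.
move=> p_gt0 Ml.
have pe e : (1 <= p ^ e)%N by rewrite expn_gt0 p_gt0.
have E e : (M %| p ^ e - 1)%N = (p ^ e == 1 %[mod M])%N by rewrite eqn_mod_dvd.
have {}Ml : (p ^ l = 1 %[mod M])%N by apply/eqP; rewrite -E.
rewrite !E.
have -> : (p ^ k = (p ^ l) ^ (k %/ l) * p ^ (k %% l))%N.
  by rewrite -expnM -expnD mulnC -divn_eq.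
by rewrite -modnMml -modnXm Ml modnXm exp1n modnMml mul1n.
Qed.

Lemma coprime_expr_eq1 (R : pzRingType) (x : R) (a b : nat) :
  (0 < a)%N -> coprime a b -> x ^+ a = 1 -> x ^+ b = 1 -> x = 1.
Proof.
move=> a_gt0 /eqP cab xa xb; have [u v E _] := egcdnP b a_gt0.
have : x ^+ (u * a) = 1 by rewrite mulnC exprM xa expr1n.
by rewrite E cab exprD mulnC exprM xb expr1n mul1r expr1.
Qed.

Lemma natr_inj_pchar (R : nzRingType) (p a b : nat) : p \in [pchar R] ->
  (a < p)%N -> (b < p)%N -> a%:R = b%:R :> R -> a = b.
Proof.
move=> charR; wlog le_ab : a b / (a <= b)%N.
  by move=> W; case/orP: (leq_total a b) => ab pa pb /esym;
    [move/esym; exact: W | move/(W b a ab pb pa)].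
move=> _ bp /eqP; rewrite eq_sym -subr_eq0 -natrB // -(dvdn_pcharf charR) => dvd.
apply/eqP; rewrite eqn_leq le_ab /= -subn_eq0.
case: (posnP (b - a)) => // ba_gt0.
by move: (dvdn_leq ba_gt0 dvd); rewrite leqNgt (leq_ltn_trans (leq_subr _ _)).
Qed.

(** The naturals below [p] already give [p] distinct roots of ['X^p - 'X], so there is no room for
    another one. *)
Lemma prime_fixed_natr (p : nat) (K : finFieldType) (x : K) :
  p \in [pchar K] -> x ^+ p = x -> exists2 n, (n < p)%N & x = n%:R.
Proof.
move=> charK xp; have p_pr := pcharf_prime charK.
pose P : {poly K} := 'X^p - 'X.
have sP : size P = p.+1.
  by rewrite size_polyDl size_polyXn // size_polyN size_polyX ltnS prime_gt1.
have P0 : P != 0 by rewrite -size_poly_eq0 sP.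
pose s := [seq n%:R : K | n <- iota 0 p].
have us : uniq s.
  rewrite map_inj_in_uniq ?iota_uniq // => a b.
  by rewrite !mem_iota !add0n /=; exact: (natr_inj_pchar charK).
case: (boolP (x \in s)) => [/mapP[n] | xs].
  by rewrite mem_iota add0n => ? ->; exists n.
have := @max_poly_roots _ P (x :: s) P0; rewrite /= xs us sP size_map size_iota.
rewrite ltnn => W.
suff: false by []; apply: W => //.
rewrite {1}/root !hornerE xp subrr eqxx /=.
apply/allP => _ /mapP[n _ ->]; rewrite /root !hornerE subr_eq0.
by rewrite -(pFrobenius_autE charK) pFrobenius_aut_nat.
Qed.

(** * The group [H], the field [L] and the conjugates of [h] *)

Section SumsOfRootsOfUnity.

Variables (p : nat) (K : finFieldType) (charK : p \in [pchar K]).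
Variables (M l : nat) (h : K).
Hypotheses (hM : M.-primitive_root h) (M_gt1 : (1 < M)%N) (l_gt1 : (1 < l)%N).
Hypothesis M_dvd : (M %| p ^ l - 1)%N.
Hypothesis lmin : forall e, (0 < e < l)%N -> coprime (p ^ e - 1) M.

Let H := [set x : K | x ^+ M == 1].
Let L := [set x : K | x ^+ (p ^ l) == x].

Let p_prime : prime p := pcharf_prime charK.
Let p_gt0 : (0 < p)%N := prime_gt0 p_prime.
Let M_gt0 : (0 < M)%N := ltnW M_gt1.

Let frobD e (x y : K) : (x + y) ^+ (p ^ e) = x ^+ (p ^ e) + y ^+ (p ^ e).
Proof. by rewrite exprDn_pchar // pnatX pnatE ?charK. Qed.

Let memH x : (x \in H) = (x ^+ M == 1). Proof. by rewrite inE. Qed.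
Let memL x : (x \in L) = (x ^+ (p ^ l) == x). Proof. by rewrite inE. Qed.

Let H1 : 1 \in H. Proof. by rewrite memH expr1n. Qed.
Let Hh : h \in H. Proof. by rewrite memH prim_expr_order. Qed.

Let HM x y : x \in H -> y \in H -> x * y \in H.
Proof. by rewrite !memH exprMn => /eqP-> /eqP->; rewrite mulr1. Qed.

Let HX x n : x \in H -> x ^+ n \in H.
Proof. by move=> Hx; elim: n => [|n IH]; rewrite ?exprS ?HM. Qed.

Let H_neq0 x : x \in H -> x != 0.
Proof.
by rewrite memH; apply: contraTneq => ->; rewrite expr0n gtn_eqF // eq_sym oner_eq0.
Qed.

Let HV x : x \in H -> x^-1 \in H.
Proof. by rewrite !memH exprVn => /eqP->; rewrite invr1. Qed.

Let sHL : {subset H <= L}.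
Proof.
move=> x; rewrite memH memL => /eqP xM; have /dvdnP[q E] := M_dvd.
have -> : (p ^ l = q * M + 1)%N by rewrite -E subnK // expn_gt0 p_gt0.
by rewrite exprD mulnC exprM xM expr1n mul1r.
Qed.

Let L0 : 0 \in L. Proof. by rewrite memL expr0n gtn_eqF // expn_gt0 p_gt0. Qed.
Let LD x y : x \in L -> y \in L -> x + y \in L.
Proof. by rewrite !memL frobD => /eqP-> /eqP->. Qed.
Let LM x y : x \in L -> y \in L -> x * y \in L.
Proof. by rewrite !memL exprMn => /eqP-> /eqP->. Qed.
Let LV x : x \in L -> x^-1 \in L.
Proof. by rewrite !memL exprVn => /eqP->. Qed.

(** Root counting yields only this bound; equality follows once [p ^ l] distinct elements are
    exhibited by [comb]. *)
Let cardL_le : (#|L| <= p ^ l)%N.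
Proof.
pose P : {poly K} := 'X^(p ^ l) - 'X.
have pl : (1 < p ^ l)%N by rewrite -(exp1n l) ltn_exp2r ?prime_gt1 // ltnW.
have sP : size P = (p ^ l).+1.
  by rewrite size_polyDl size_polyXn // size_polyN size_polyX ltnS.
have P0 : P != 0 by rewrite -size_poly_eq0 sP.
rewrite cardE -ltnS -sP max_poly_roots ?enum_uniq //.
by apply/allP => x; rewrite mem_enum memL /root !hornerE subr_eq0.
Qed.

(** The order of [x] divides both [p ^ e - 1] and [M], which [lmin] makes coprime. *)
Let frob_coprime1 x e : (0 < e < l)%N -> x \in H -> x ^+ (p ^ e) = x -> x = 1.
Proof.
move=> el Hx xe; have x0 := H_neq0 Hx.
have := coprime_expr_eq1 _ (lmin el); apply.
- rewrite subn_gt0 -(exp1n e) ltn_exp2r ?prime_gt1 //; by case/andP: el.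
- by apply: (mulIf x0); rewrite -exprSr subn1 prednK ?mul1r // expn_gt0 p_gt0.
- by apply/eqP; rewrite -memH.
Qed.

Let h_neq1 : h != 1.
Proof.
by rewrite -(expr1 h) -(prim_order_dvd hM) dvdn1 gtn_eqF.
Qed.

Let coprime_pM : coprime p M.
Proof.
rewrite prime_coprime //; apply/negP => pM.
have := dvdn_trans pM M_dvd; rewrite -[l]prednK 1?ltnW // expnS.
rewrite dvdn_subr ?dvdn_mulr ?muln_gt0 ?p_gt0 ?expn_gt0 ?p_gt0 //.
by rewrite gtnNdvd ?prime_gt1.
Qed.

(* The [l] conjugates [h ^+ (p ^ j)], [j < l], are distinct roots of [q]. *)
Let frob_fixed_poly_eq0 (q : {poly K}) : (size q <= l)%N ->
  (forall i, q`_i ^+ p = q`_i) -> q.[h] = 0 -> q = 0.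
Proof.
move=> sq qp qh; apply/eqP/negPn/negP => q0.
pose s := [seq h ^+ (p ^ j) | j <- iota 0 l].
suff /(max_poly_roots q0) : all (root q) s.
  rewrite size_map size_iota ltnNge sq => W; suff: false by []; apply: W.
  rewrite map_inj_in_uniq ?iota_uniq // => a b; rewrite !mem_iota !add0n /=.
  wlog le_ab : a b / (a <= b)%N.
    by move=> W; case/orP: (leq_total a b) => ab pa pb /esym;
      [move/esym; exact: W | move/(W b a ab pb pa)].
  move=> al bl E; apply/eqP; rewrite eqn_leq le_ab /= leqNgt; apply/negP => lt_ab.
  have Ha : h ^+ (p ^ a) \in H by exact: HX.
  (* Two equal conjugates make [h ^+ (p ^ a)] fixed by the Frobenius power of exponent [b - a],
     hence equal to 1; but [p ^ a] is coprime to the order [M] of [h]. *)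
  have := @frob_coprime1 _ (b - a) _ Ha.
  rewrite -exprM -expnD subnKC // subn_gt0 lt_ab (leq_ltn_trans (leq_subr _ _)) //.
  move=> /(_ isT (esym E)) /eqP; rewrite -(prim_order_dvd hM) => dvd.
  have : coprime M (p ^ a) by rewrite coprimeXr // coprime_sym coprime_pM.
  by rewrite /coprime (gcdn_idPl dvd) gtn_eqF.
apply/allP => _ /mapP[j _ ->]; apply/rootP.
have qF : map_poly (pFrobenius_aut charK) q = q.
  by apply/polyP => i; rewrite coef_map /= pFrobenius_autE qp.
elim: j => [|j IH]; first by rewrite expn0 expr1.
by rewrite expnSr exprM -(pFrobenius_autE charK) -{1}qF horner_map /= IH rmorph0.
Qed.

(** * [L] as the span of the powers of [h] over the prime field *)

Let LN x : x \in L -> - x \in L.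
Proof.
rewrite !memL => /eqP xl; rewrite -subr_eq0 opprK -{2}xl -frobD addNr.
by rewrite expr0n gtn_eqF // expn_gt0 p_gt0.
Qed.

(** Coefficients are naturals below [p]: there are then [p ^ l] families to count, and adding a
    combination is a repeated addition of elements of [H]. *)
Let comb (c : {ffun 'I_l -> 'I_p}) : K := \sum_(i < l) (h ^+ i) *+ c i.

Let Lcomb c : comb c \in L.
Proof.
rewrite /comb; elim/big_ind: _ => [||i _]; [exact: L0 | exact: LD |].
by elim: (c i : nat) => [|n IH]; rewrite ?mulr0n ?L0 // mulrS LD // sHL ?HX.
Qed.

(** The difference of two combinations is the value at [h] of a polynomial of degree below [l] over
    the prime field, to which [frob_fixed_poly_eq0] applies. *)
Let comb_inj : injective comb.
Proof.
move=> c c' E; pose u i : K := if insub i is Some j then (c j)%:R - (c' j)%:R else 0.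
pose q := \poly_(i < l) u i.
have : q = 0.
  apply: frob_fixed_poly_eq0; first exact: size_poly.
    move=> i; rewrite coef_poly; case: ifP => _; last by rewrite expr0n gtn_eqF.
    rewrite /u; case: insubP => [j _ _|_]; last by rewrite expr0n gtn_eqF.
    by rewrite -(pFrobenius_autE charK) rmorphB /= !pFrobenius_aut_nat.
  rewrite horner_poly; apply/eqP; move/eqP: E; rewrite -subr_eq0 -sumrB.
  congr (_ == 0); apply: eq_bigr => i _.
  by rewrite /u valK mulrBl !mulr_natl.
move=> q0; apply/ffunP => i; apply: val_inj.
apply: (natr_inj_pchar charK); rewrite ?ltn_ord //.
have : q`_i = 0 by rewrite q0 coef0.
by rewrite coef_poly ltn_ord /u valK => /eqP; rewrite subr_eq0 => /eqP.
Qed.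

Let L_comb : L = [set comb c | c : {ffun 'I_l -> 'I_p}].
Proof.
apply/esym/eqP; rewrite eqEcard card_imset // card_ffun !card_ord cardL_le.
by rewrite andbT; apply/subsetP => _ /imsetP[c _ ->].
Qed.

Let card_L : #|L| = (p ^ l)%N.
Proof.
by rewrite L_comb card_imset // card_ffun !card_ord.
Qed.

(** The translations preserving [Z] are closed under addition and under multiplication by [H].
    Containing [t], they contain every [comb c * t], that is, all of [L]. *)
Let stable_full (Z : {set K}) z0 t : z0 \in Z -> {subset Z <= L} ->
    (forall a z, a \in H -> z \in Z -> a * z \in Z) ->
    t \in L -> t != 0 -> (forall z, z \in Z -> z + t \in Z) ->
  {subset L <= Z}.
Proof.
move=> Zz0 sZL HZ Lt t0 Zt y Ly.
pose st x := forall z, z \in Z -> z + x \in Z.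
have stD x x' : st x -> st x' -> st (x + x').
  by move=> sx sx' z Zz; rewrite addrA sx' ?sx.
have st0 : st 0 by move=> z; rewrite addr0.
have stH a x : a \in H -> st x -> st (a * x).
  move=> Ha sx z Zz; have -> : z + a * x = a * (a^-1 * z + x).
    by rewrite mulrDr mulrA divff ?mul1r ?H_neq0.
  by rewrite HZ // sx // HZ // HV.
have : (y - z0) / t \in [set comb c | c : {ffun 'I_l -> 'I_p}].
  by rewrite -L_comb LM ?LV // LD // LN // sZL.
case/imsetP => c _ E; have {E} <- : z0 + comb c * t = y.
  by rewrite -E mulfVK // addrC subrK.
suff : st (comb c * t) by apply.
rewrite /comb; elim/big_rec: _ => [|i x _ sx]; first by rewrite mul0r.
rewrite mulrDl; apply: (stD) => //; rewrite mulrnAl.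
by elim: (c i : nat) => [//|n IH]; rewrite mulrS; apply: (stD) => //; apply/stH/Zt; apply: HX.
Qed.

(** * Cardinalities of [H]-stable sets *)

Let card_H : #|H| = M.
Proof.
have -> : H = [set h ^+ (i : 'I_M) | i : 'I_M].
  apply/setP => x; apply/idP/imsetP => [|[i _ ->]]; last exact: HX.
  by rewrite memH => /eqP/(prim_rootP hM)[i ->]; exists i.
rewrite card_imset ?card_ord // => i j /eqP.
by rewrite (eq_prim_root_expr hM) !modn_small // => /eqP/val_inj.
Qed.

Definition mulH_stable (X : {set K}) :=
  forall a x, a \in H -> x \in X -> a * x \in X.

(** The fibres of [x ^+ M] on [X] are cosets of [H], with [M] elements each. *)
Let dvd_card_stable (X : {set K}) : mulH_stable X -> 0 \notin X -> (M %| #|X|)%N.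
Proof.
move=> HX' X0; rewrite -sum1_card (partition_big_imset (fun x => x ^+ M)) /=.
apply: dvdn_sum => _ /imsetP[x Xx ->]; rewrite sum1dep_card.
have x0 : x != 0 by apply: contraNneq X0 => <-.
have -> : [set y | (y \in X) && (y ^+ M == x ^+ M)] = [set a * x | a in H].
  apply/setP => y; rewrite inE; apply/idP/imsetP => [/andP[Xy /eqP E]|[a Ha ->]].
    exists (y / x); last by rewrite mulfVK.
    by rewrite memH expr_div_n E divff ?expf_neq0.
  by rewrite HX' // exprMn; move: Ha; rewrite memH => /eqP->; rewrite mul1r eqxx.
by rewrite card_imset ?card_H //; apply: mulIf.
Qed.

Let stableD0 X : mulH_stable X -> mulH_stable (X :\ 0).
Proof.
move=> sX a x Ha; rewrite !in_setD1 => /andP[x0 Xx].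
by rewrite mulf_neq0 ?sX // H_neq0.
Qed.

(** Otherwise [h] would lie in the prime field and equal 1 by [frob_coprime1]. *)
Let independent_h (a b : K) : a ^+ p = a -> b ^+ p = b -> a * h + b = 0 -> a = 0.
Proof.
move=> ap bp E; apply/eqP/negPn/negP => a0.
have Eh : h = - b / a.
  by apply: (mulIf a0); rewrite divfK // mulrC; apply/eqP; rewrite -addr_eq0 E.
case/negP: h_neq1; apply/eqP/(@frob_coprime1 _ 1) => //.
rewrite expn1 Eh -(pFrobenius_autE charK) rmorphM rmorphN fmorphV /=.
by rewrite !pFrobenius_autE ap bp.
Qed.

(** * Growth of a stable set when [H] is added *)

Let sumH (Z : {set K}) := [set z + a | z in Z, a in H].

Let mem_sumH (Z : {set K}) z a : z \in Z -> a \in H -> z + a \in sumH Z.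
Proof. exact: imset2_f. Qed.

Let sumH_stable (Z : {set K}) : mulH_stable Z -> mulH_stable (sumH Z).
Proof.
by move=> sZ a _ Ha /imset2P[z b Zz Hb ->]; rewrite mulrDr mem_sumH ?sZ ?HM.
Qed.

Let sumH_subL (Z : {set K}) : {subset Z <= L} -> {subset sumH Z <= L}.
Proof. by move=> sZ _ /imset2P[z a Zz Ha ->]; apply: LD; [apply: sZ | apply: sHL]. Qed.

Let nat_frob n : (n%:R : K) ^+ p = n%:R.
Proof. by rewrite -(pFrobenius_autE charK) pFrobenius_aut_nat. Qed.

Let h1_neq0 : h - 1 != 0. Proof. by rewrite subr_eq0. Qed.
Let Lh1 : h - 1 \in L. Proof. by rewrite LD ?LN ?(sHL Hh) ?(sHL H1). Qed.

(* Scaling by [a] in [H], the set [U := sumH Z] has exactly one element [a * c]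
   more than [Z + a], so [U - a] and [U - b] differ only in two points.  Unless
   [c] is 0 or 1, walking from [h * c] with step [h - 1] forces [c] into the
   prime field; walking along the other two sides of the triangle with vertices
   1, [h], [h ^+ 2] then leads from a point outside [U] to
   [h ^+ 2 * c], which is in [U]. *)
Let excess_point (Z : {set K}) c : mulH_stable Z -> 0 \notin Z -> 0 \in sumH Z ->
    {subset Z <= L} -> sumH Z = c |: [set z + 1 | z in Z] ->
    c \notin [set z + 1 | z in Z] ->
  {subset L <= sumH Z}.
Proof.
set U := sumH Z => sZ Z0 U0 sZL EU cT y Ly.
have sU : mulH_stable U := sumH_stable sZ.
have F1 u a : u \in U -> a \in H -> u != a * c -> u - a \in Z.
  move=> Uu Ha uac; have a0 := H_neq0 Ha; have : a^-1 * u \in U by rewrite sU ?HV.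
  rewrite EU inE inE => /orP[/eqP E|/imsetP[z Zz E]].
    by case/eqP: uac; rewrite -E mulVKf.
  have -> : u - a = a * z by rewrite -[u](mulVKf a0) E mulrDr mulr1 addrK.
  exact: sZ.
have F3 z a : z \in Z -> a \in H -> z + a != a * c.
  move=> Zz Ha; have a0 := H_neq0 Ha; apply: contraNneq cT => E.
  apply/imsetP; exists (a^-1 * z); first by rewrite sZ ?HV.
  by rewrite -[c](mulKf a0) -E mulrDr mulVf.
have Uc : c \in U by rewrite EU setU11.
(* A move trades the summand [a] for [b]: it is blocked only at [a * c] and never ends at [b * c].
   All walks below consist of such moves. *)
have star a b u : a \in H -> b \in H -> u \in U -> u != a * c ->
    u - a + b \in U /\ u - a + b != b * c.
  by move=> Ha Hb Uu uac; split; [apply: mem_sumH | apply: F3] => //; apply: F1.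
(* For [c = 0], [Z] itself is stable under translation by [h - 1], so it would contain [L] and hence
   0. *)
have [c0|c0] := eqVneq c 0.
  case/negP: Z0; have Z1 : -1 \in Z.
    have [z a Zz Ha /eqP E] := imset2P U0; rewrite eq_sym addr_eq0 in E.
    have -> : -1 = a^-1 * z by rewrite (eqP E) mulrN mulVf // H_neq0.
    by rewrite sZ ?HV.
  apply: (stable_full Z1 sZL sZ Lh1 h1_neq0 _ L0) => z Zz.
  rewrite addrA F1 ?mem_sumH // mul1r c0.
  by have := F3 _ _ Zz Hh; rewrite c0 mulr0.
(* For [c = 1], the move from 1 to [h] is blocked only at 1, but [1 + (h - 1) = h * c] is in [U]
   anyway. *)
have [c1|c1] := eqVneq c 1.
  apply: (stable_full U0 (sumH_subL sZL) sU Lh1 h1_neq0 _ Ly) => u Uu.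
  have [->|u1] := eqVneq u 1; first by rewrite addrC subrK -[h]mulr1 -c1 sU.
  by rewrite addrCA addrC; case: (star 1 h u) => //; rewrite c1 mulr1.
exfalso.
have [k Ek] : exists k, c - 1 = k%:R.
  suff [j /eqP Ej] : exists j : 'I_p, h * c + j%:R * (h - 1) == c.
    have [|k _ Ek] := @prime_fixed_natr p K (c - 1) charK; last by exists k.
    have -> : c - 1 = - j.+1%:R.
      apply: (mulIf h1_neq0); apply/eqP; rewrite -subr_eq0 -natr1.
      have -> : (c - 1) * (h - 1) - - (j%:R + 1) * (h - 1) =
        h * c + j%:R * (h - 1) - c by ring.
      by rewrite Ej subrr.
    by rewrite -(pFrobenius_autE charK) rmorphN /= pFrobenius_aut_nat.
  apply/existsP; apply: contraT => /existsPn N.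
  have N' j : h * c + j%:R * (h - 1) != c.
    have := N (Ordinal (ltn_pmod j p_gt0)); rewrite /= GRing.natr_mod_pchar //.
  have W j : h * c + j%:R * (h - 1) \in U.
    elim: j => [|j IH]; first by rewrite mul0r addr0 sU.
    case: (star 1 h _ H1 Hh IH) => [|+ _]; rewrite ?mul1r //.
    by congr (_ \in U); rewrite -natr1; ring.
  (* A walk that never meets [c] returns to [h * c] at the [p]-th move, where no move from 1 to [h]
     can end. *)
  case: (star 1 h _ H1 Hh (W p.-1)) => [|_ /eqP[]]; rewrite ?mul1r //.
  have : (p.-1)%:R = -1 :> K.
    by apply/eqP; rewrite -addr_eq0 natr1 prednK // -(dvdn_pcharf charK).
  by move=> ->; ring.
have {Ek} Ec : c = k%:R + 1 by rewrite -Ek subrK.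
have k0 : k%:R != 0 :> K by apply: contra_neq c1 => E; rewrite Ec E add0r.
have Hh2 : h ^+ 2 \in H by apply: HX.
have hh : h != 0 by apply: H_neq0.
(* From [Q], trading [h ^+ 2] for [h] would end at the forbidden point [h * c]. *)
pose Q := h * c + h ^+ 2 - h.
have NQ : Q \notin U.
  apply/negP => UQ; case: (star _ _ _ Hh2 Hh UQ) => [|_].
    rewrite -subr_eq0; have -> : Q - h ^+ 2 * c = - (h * (h - 1) * k%:R).
      by rewrite /Q Ec; ring.
    by rewrite oppr_eq0 !mulf_neq0.
  by case/eqP; rewrite /Q; ring.
(* Trading [h ^+ 2] for 1 leads back to the previous point, so being outside [U] propagates;
   [independent_h] shows that the blocked point [h ^+ 2 * c] is not met. *)
have NQ1 j : Q + j%:R * (h ^+ 2 - 1) \notin U.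
  elim: j => [|j IH]; first by rewrite mul0r addr0.
  apply: contra IH => Uu; case: (star _ _ _ Hh2 H1 Uu) => [|+ _].
    apply: contra k0; rewrite -subr_eq0.
    have -> : Q + j.+1%:R * (h ^+ 2 - 1) - h ^+ 2 * c =
        (h - 1) * ((j.+1%:R - k%:R) * h + j.+1%:R) by rewrite /Q Ec; ring.
    rewrite mulf_eq0 (negPf h1_neq0) /= => /eqP E.
    have E0 : j.+1%:R - k%:R = 0 :> K.
      apply: independent_h E => //.
      by rewrite -(pFrobenius_autE charK) rmorphB /= !pFrobenius_aut_nat.
    by move: E; rewrite E0 mul0r add0r => E; move: E0; rewrite E sub0r => /eqP; rewrite oppr_eq0.
  by congr (_ \in U); rewrite -natr1; ring.
have NQ2 i : h ^+ 2 * c + (k + i)%:R * (h - 1) \notin U.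
  elim: i => [|i IH].
    have := NQ1 k; congr (_ \notin U); rewrite addn0 /Q Ec; ring.
  apply: contra IH => Uu; case: (star _ _ _ Hh H1 Uu) => [|+ _].
    apply: contra c0; rewrite -subr_eq0.
    have -> : h ^+ 2 * c + (k + i.+1)%:R * (h - 1) - h * c =
        (h - 1) * (c * h + (k + i.+1)%:R) by ring.
    rewrite mulf_eq0 (negPf h1_neq0) /= => /eqP E; apply/eqP.
    by apply: independent_h E => //; rewrite Ec natr1.
  by congr (_ \in U); rewrite addnS -natr1; ring.
(* Here [k + k * p.-1 = k * p] vanishes in [K], so the walk has reached [h ^+ 2 * c]. *)
have := NQ2 (k * p.-1)%N; rewrite -mulnS prednK // natrM (pcharf0 charK) mulr0 mul0r.
by rewrite addr0 sU.
Qed.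

Local Notation nz X := (X :\ 0%R).

(** Both counts are multiples of [M], so any increase is at least [M]. Without increase, either all
    translates [Z + a] equal [sumH Z], which is then stable under translation by [h - 1], or
    [sumH Z] has gained only 0 in size and [excess_point] applies. *)
Let growth (Z : {set K}) z0 : z0 \in Z -> mulH_stable Z -> {subset Z <= L} ->
  {subset L <= sumH Z} \/ (#|nz Z| + M <= #|nz (sumH Z)|)%N.
Proof.
move=> Zz0 sZ sZL; set U := sumH Z.
have sU : mulH_stable U := sumH_stable sZ.
have [lt_ZU|le_UZ] := ltnP #|nz Z| #|nz U|.
  right; have dvd X : mulH_stable X -> (M %| #|nz X|)%N.
    by move=> sX; rewrite dvd_card_stable ?setD11 //; apply: stableD0.
  have /dvdnP[a Ea] := dvd _ sZ; have /dvdnP[b Eb] := dvd _ sU.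
  by move: lt_ZU; rewrite Ea Eb ltn_pmul2r // -mulSnr leq_pmul2r.
left; have sTU a : a \in H -> [set z + a | z in Z] \subset U.
  by move=> Ha; apply/subsetP => _ /imsetP[z Zz ->]; apply: mem_sumH.
have cT a : #|[set z + a | z in Z]| = #|Z| by rewrite card_imset //; apply: addIr.
have [le_cUZ | lt_cZU] := leqP #|U| #|Z|.
  have ET a : a \in H -> [set z + a | z in Z] = U.
    by move=> Ha; apply/eqP; rewrite eqEcard sTU // cT.
  have Uz : z0 + 1 \in U by apply: mem_sumH.
  apply: (stable_full Uz (sumH_subL sZL) sU Lh1 h1_neq0) => u.
  rewrite -{1}(ET _ H1) => /imsetP[z Zz ->].
  by rewrite addrC -addrA [-1 + _]addrC addrK addrC; apply: mem_sumH.
have := cardsD1 0 U; have := cardsD1 0 Z => EZ EU.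
have [U0 Z0] : 0 \in U /\ 0 \notin Z.
  move: lt_cZU; rewrite EU EZ; case: (0 \in U); case: (0 \in Z) => //.
  - by rewrite !add1n ltnS ltnNge le_UZ.
  - by rewrite add0n add1n => /ltnW; rewrite ltnNge le_UZ.
  - by rewrite !add0n ltnNge le_UZ.
set T := [set z + 1 | z in Z].
have /eqP/cards1P[c Ec] : #|U :\: T| = 1%N.
  apply/eqP; rewrite cardsD (setIidPr (sTU _ H1)) cT EU U0 EZ (negPf Z0) add0n.
  rewrite eqn_leq subn_gt0 leq_subLR addnC leq_add2r le_UZ /=.
  by move: lt_cZU; rewrite EU U0 EZ (negPf Z0) add0n addnC.
have : c \in U :\: T by rewrite Ec set11.
rewrite inE => /andP[cT' Uc].
apply: (excess_point sZ Z0 U0 sZL _ cT').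
by rewrite -Ec -{1}(setID (sumH Z) T) (setIidPr (sTU _ H1)) setUC.
Qed.

(** * Iterated sumsets of [H] *)

Fixpoint nsumH (n : nat) : {set K} :=
  if n is n'.+1 then sumH (nsumH n') else [set 0].

Let nsum_stable n : mulH_stable (nsumH n).
Proof.
elim: n => [|n IH]; last exact: sumH_stable.
by move=> a x _; rewrite !inE => /eqP->; rewrite mulr0.
Qed.

Let nsum_subL n : {subset nsumH n <= L}.
Proof.
elim: n => [|n IH]; last exact: sumH_subL.
by move=> x /set1P->; apply: L0.
Qed.

Let nsumD m n x y : x \in nsumH m -> y \in nsumH n -> x + y \in nsumH (m + n).
Proof.
move=> Sx; elim: n y => [|n IH] y /=; first by move=> /set1P->; rewrite addn0 addr0.
by move=> /imset2P[z a Sz Ha ->]; rewrite addnS addrA mem_sumH ?IH.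
Qed.

Let nsumMn n x k : x \in nsumH n -> x *+ k \in nsumH (k * n).
Proof.
move=> Sx; elim: k => [|k IH]; first by rewrite mulr0n inE.
by rewrite mulrS mulSn nsumD.
Qed.

Let nsum1 a : a \in H -> a \in nsumH 1.
Proof. by move=> Ha; rewrite -[a]add0r; apply: mem_sumH; rewrite /= ?set11. Qed.

Let nsum_nat n : n%:R \in nsumH n.
Proof. by rewrite -[X in nsumH X]muln1; apply/nsumMn/nsum1. Qed.

Let nsum_frob n x : x \in nsumH n -> x ^+ p \in nsumH n.
Proof.
elim: n x => [|n IH] x /=; first by move=> /set1P->; rewrite expr0n gtn_eqF ?inE.
move=> /imset2P[z a Sz Ha ->]; rewrite -(pFrobenius_autE charK) rmorphD /=.
by rewrite !pFrobenius_autE mem_sumH ?IH ?HX.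
Qed.

Let nsum_in_W n : 0 \in nsumH n -> in_W K M n.
Proof.
suff W x : x \in nsumH n -> exists alpha : 'I_n -> K,
    (forall i, alpha i ^+ M = 1) /\ \sum_(i < n) alpha i = x by apply: W.
elim: n x => [|n IH] x /=.
  by move=> /set1P->; exists (fun=> 0); split=> [[]//|]; rewrite big_ord0.
case/imset2P => z a /IH[alpha [aH aS]] Ha ->.
exists (fun i => if unlift ord_max i is Some j then alpha j else a); split.
  by move=> i; case: unliftP => [j _|_]; [apply: aH | apply/eqP; rewrite -memH].
rewrite big_ord_recr /= unlift_none -aS; congr (_ + _); apply: eq_bigr => i _.
have -> : widen_ord (leqnSn n) i = lift ord_max i by apply/val_inj; rewrite /= /bump leqNgt ltn_ord.
by rewrite liftK.
Qed.

(** * Counting cosets until [L] is filled *)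

Let d := ((p ^ l - 1) %/ M)%N.

Let dM : (d * M = p ^ l - 1)%N. Proof. exact: divnK. Qed.

Let card_L0 : #|nz L| = (d * M)%N.
Proof. by rewrite dM -card_L (cardsD1 0 L) L0 add1n subn1. Qed.

Let full n := nz L \subset nsumH n.

Let nsum_le n : nz (nsumH n) \subset nz L.
Proof. by apply: setSD; apply/subsetP/nsum_subL. Qed.

Let fullE n : full n = (d * M <= #|nz (nsumH n)|)%N.
Proof.
rewrite -card_L0 (geq_leqif (subset_leqif_cards (nsum_le n))) eqEsubset nsum_le /full /=.
by apply/idP/idP => [|/subset_trans]; [rewrite subsetD1 setD11 andbT | apply; apply: subsetDl].
Qed.

Let full_zero n : full n -> 0 \in nsumH n.+1.
Proof.
move=> /subsetP F; rewrite -(addNr 1) mem_sumH // F // in_setD1 oppr_eq0 oner_eq0 /=.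
by rewrite LN // sHL.
Qed.

Let fullS n : full n -> full n.+1.
Proof.
move=> /subsetP F; apply/subsetP => x; rewrite in_setD1 => /andP[_ Lx].
have [a Ha xa] : exists2 a, a \in H & x != a.
  by have [->|] := eqVneq x 1; [exists h; rewrite // eq_sym | exists 1].
by rewrite -(subrK a x) mem_sumH // F // in_setD1 subr_eq0 xa /= LD // LN // sHL.
Qed.

Let full_le m n : (m <= n)%N -> full m -> full n.
Proof. by move=> /subnKC<-; elim: (n - m)%N => [|k IH]; rewrite ?addn0 ?addnS // => /IH/fullS. Qed.

(** By [growth], each new summand contributes a coset until fullness, so a head start of [c] cosets
    is never lost. *)
Let full_or_wide c n i : (c * M <= #|nz (nsumH n)|)%N ->
  full (n + i) \/ ((c + i) * M <= #|nz (nsumH (n + i))|)%N.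
Proof.
move=> cn; elim: i => [|i IH]; first by rewrite !addn0; right.
case: IH => [F|le]; first by left; rewrite addnS fullS.
rewrite !addnS mulSn [(M + _)%N]addnC.
have [F|le'] := growth (nsum_nat (n + i)) (@nsum_stable _) (@nsum_subL _).
  by left; exact: subset_trans (subsetDl _ _) (introT subsetP F).
by right; apply: leq_trans le'; rewrite leq_add2r.
Qed.

Let full_from c n i : (c * M <= #|nz (nsumH n)|)%N -> (d <= c + i)%N -> full (n + i).
Proof.
move=> cn di; case: (full_or_wide i cn) => // le.
by rewrite fullE (leq_trans _ le) // leq_pmul2r.
Qed.

Let full_d : full d.
Proof. by rewrite -[d]add0n (@full_from 0). Qed.

Let zero_gt n : (d < n)%N -> 0 \in nsumH n.
Proof. by case: n => // n dn; apply/full_zero/(full_le (dn : (d <= n)%N))/full_d. Qed.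

(** Three cosets after two summands give fullness already at [d - 1], and the next summand gives
    0. *)
Let zero_of_wide n : (3 * M <= #|nz (nsumH 2)|)%N -> (d <= n)%N -> 0 \in nsumH n.
Proof.
move=> w dn; have d3 : (2 < d)%N.
  by rewrite -(leq_pmul2r M_gt0) (leq_trans w) // -card_L0 subset_leq_card.
have := leq_trans d3 dn; case: n dn => [|[|[|n]]] // dn _.
exact/full_zero/(full_from w (dn : (d <= 3 + n)%N)).
Qed.

Let card_nsum2 : (2 < d)%N -> (#|nz (nsumH 2)| < 3 * M)%N -> #|nz (nsumH 2)| = (2 * M)%N.
Proof.
move=> d3; have /dvdnP[q E] : (M %| #|nz (nsumH 2)|)%N.
  by rewrite dvd_card_stable ?setD11 //; apply: stableD0.
have := @full_or_wide 0 0 2 (leq0n _); rewrite !add0n E => -[F|].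
  move: F; rewrite fullE E => F q3; move: (leq_ltn_trans F q3).
  by rewrite ltn_pmul2r // ltnNge d3.
by rewrite leq_pmul2r // ltn_pmul2r // ltnS => q2 q2'; rewrite (@anti_leq q 2) ?q2 ?q2'.
Qed.

(** * Exactly two nonzero cosets in the twofold sumset *)

Let root_H e a : coprime e M -> (0 < e)%N -> a \in H -> exists2 b, b \in H & b ^+ e = a.
Proof.
move=> cop e_gt0 Ha; have [u v E _] := egcdnP M e_gt0; rewrite (eqP cop) in E.
exists (a ^+ u); first exact: HX.
by rewrite -exprM E exprD mulnC exprM (eqP (_ : a ^+ M == 1)) -?memH // expr1n mul1r.
Qed.

Let coset_sub (X : {set K}) (g : K) :
  mulH_stable X -> g \in X -> [set a * g | a in H] \subset X.
Proof. by move=> sX Xg; apply/subsetP => _ /imsetP[a Ha ->]; apply: sX. Qed.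

Let card_coset (g : K) : g != 0 -> #|[set a * g | a in H]| = M.
Proof. by move=> g0; rewrite card_imset ?card_H //; apply: mulIf. Qed.

Let p1_gt0 : (0 < p - 1)%N. Proof. by rewrite subn_gt0 prime_gt1. Qed.

Let coprime_p1M : coprime (p - 1) M.
Proof. by rewrite -[p in (p - 1)%N]expn1 lmin. Qed.

Let d_gt0 : (0 < d)%N.
Proof.
rewrite -(ltn_pmul2r M_gt0) dM mul0n subn_gt0 -(exp1n l).
by rewrite ltn_exp2r ?prime_gt1 // ltnW.
Qed.

(** As [p - 1] divides [d * M] and is coprime to [M], it divides [d]. *)
Let mul2p1_le_d : d <> (p - 1)%N -> ((p - 1) * 2 <= d)%N.
Proof.
move=> dp; have /dvdnP[q Eq] : (p - 1 %| d)%N.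
  rewrite -(Gauss_dvdl _ coprime_p1M) dM.
  by have := subn_exp p 1 l; rewrite exp1n => ->; apply: dvdn_mulr.
rewrite Eq mulnC leq_pmul2r //; move: d_gt0 dp.
by rewrite Eq; case: (q) => [|[|]] //; rewrite mul1n.
Qed.

(** Frobenius preserves the coset of 2, hence also the other one, so [g ^+ p = b * g] with [b] in
    [H]. Scaling [g] by a [(p - 1)]-th root of [b^-1] gives a prime-field element [u] other than 2.
    Mixing [p - 1] copies of 2 and [u] reaches every residue. *)
Let odd_case n : odd p -> d <> (p - 1)%N -> #|nz (nsumH 2)| = (2 * M)%N ->
  (d <= n)%N -> 0 \in nsumH n.
Proof.
move=> p_odd dp c2 dn; have co := coprime_p1M.
have le_n := leq_trans (mul2p1_le_d dp) dn.
have two0 : 2%:R != 0 :> K.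
  rewrite -(dvdn_pcharf charK) gtnNdvd // ltn_neqAle prime_gt1 // andbT.
  by apply: contraTneq p_odd => <-.
set X := nz (nsumH 2).
have sX : mulH_stable X by apply/stableD0/nsum_stable.
have X2 : 2%:R \in X by rewrite in_setD1 two0 nsum_nat.
pose Y : {set K} := [set a * 2%:R | a in H].
have cW : #|X :\: Y| = M.
  by rewrite cardsD (setIidPr (coset_sub sX X2)) c2 card_coset // mulSn mul1n addnK.
have inY (g : K) : g \in nsumH 2 -> g != 0 -> g \notin Y -> g \in X :\: Y.
  by move=> Sg g0 gY; apply/setDP; rewrite in_setD1 g0.
have [g Wg] : exists g : K, g \in X :\: Y by apply/set0Pn; rewrite -card_gt0 cW.
have [gY g0 Sg] : [/\ g \notin Y, g != 0 & g \in nsumH 2].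
  by case/setDP: Wg => /setD1P[].
have sW : mulH_stable (X :\: Y).
  move=> a x Ha /setDP[Xx xY]; apply/setDP; split; first exact: sX.
  have a0 := H_neq0 Ha; apply: contra xY => /imsetP[b Hb E].
  apply/imsetP; exists (a^-1 * b); first by rewrite HM ?HV.
  by rewrite -mulrA -E mulKf.
have /imsetP[b Hb Eb] : g ^+ p \in [set a * g | a in H].
  have EW : [set a * g | a in H] = X :\: Y.
    by apply/eqP; rewrite eqEcard (coset_sub sW Wg) cW (card_coset g0) leqnn.
  rewrite EW; apply: inY; rewrite ?expf_neq0 ?nsum_frob //.
  (* [a] is a [p]-th power in [H] and Frobenius is injective and fixes 2, so [g] would lie in
     [Y]. *)
  apply: contra gY => /imsetP[a Ha E]; have [c Hc Ec] := root_H coprime_pM p_gt0 Ha.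
  apply/imsetP; exists c => //; apply: (fmorph_inj (pFrobenius_aut charK)).
  by rewrite rmorphM /= pFrobenius_aut_nat !pFrobenius_autE Ec.
have [c Hc Ec] := root_H co p1_gt0 (HV Hb).
have cp : c ^+ p = b^-1 * c by rewrite -Ec -exprSr subn1 prednK.
have [|u _ Eu] := @prime_fixed_natr p K (c * g) charK.
  by rewrite exprMn cp Eb mulrACA mulVf ?mul1r ?H_neq0.
have Su : u%:R \in nsumH 2 by rewrite -Eu; exact: (@nsum_stable 2 c g Hc Sg).
have u2 : 2%:R - u%:R != 0 :> K.
  rewrite subr_eq0 -Eu; apply: contraNneq gY => E; apply/imsetP.
  by exists c^-1; [exact: HV | rewrite E mulKf ?H_neq0].
(* Then [0 = i * 2 + (p - 1 - i) * u + r] for the residue [i = (u - r) / (2 - u)]. *)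
pose r := (n - (p - 1) * 2)%N.
have [|i ip Ei] := @prime_fixed_natr p K ((u%:R - r%:R) / (2%:R - u%:R)) charK.
  rewrite -(pFrobenius_autE charK) fmorph_div !rmorphB /=.
  by rewrite !pFrobenius_aut_nat.
have ip1 : (i <= p - 1)%N by rewrite subn1 -ltnS prednK.
have En : (n = i * 2 + (p - 1 - i) * 2 + r)%N by rewrite -mulnDl subnKC // subnKC.
clearbody r.
have <- : 2%:R *+ i + u%:R *+ (p - 1 - i) + r%:R = 0 :> K.
  rewrite -[2%:R *+ i]mulr_natl -[u%:R *+ _]mulr_natl !natrB ?prime_gt0 //.
  by rewrite (pcharf0 charK) -Ei; field.
rewrite En; apply: nsumD (nsum_nat r).
by apply: nsumD; apply: nsumMn; [apply: nsum_nat | apply: Su].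
Qed.

(** Since [1 + 1 = 0], even [n] are immediate and odd [n] reduce to 5. If 1 is not a sum of two
    roots, squaring swaps the cosets of [g] and [g ^+ 2], so [g ^+ 3] is in [H]; scaling gives a
    primitive cube root of unity [w], and [w + w ^+ 2 + 1] uses [2 + 2 + 1] summands. *)
Let even_case n : p = 2%N -> (4 < d)%N -> #|nz (nsumH 2)| = (2 * M)%N ->
  (d <= n)%N -> 0 \in nsumH n.
Proof.
move=> p2 d4 c2 dn; have two0 : 2%:R = 0 :> K by rewrite -p2 (pcharf0 charK).
have S2 : 0 \in nsumH 2 by rewrite -two0 nsum_nat.
have S2k k : 0 \in nsumH (k * 2) by rewrite -(mul0rn _ k); apply: nsumMn.
suff S5 : 0 \in nsumH 5.
  rewrite -(odd_double_half n) -muln2; case: (odd n); last by rewrite add0n.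
  have n2 : (2 <= n./2)%N by rewrite -[2%N]/(5./2) half_leq // (leq_trans d4).
  have -> : (1 + n./2 * 2 = 5 + (n./2 - 2) * 2)%N.
    by rewrite -{1}(subnK n2) mulnDl addnCA addnC.
  by rewrite -[0]addr0; apply: nsumD.
set X := nz (nsumH 2).
have sX : mulH_stable X by apply/stableD0/nsum_stable.
have Xfrob x : x \in X -> x ^+ 2 \in X.
  by rewrite !in_setD1 => /andP[x0 Sx]; rewrite expf_neq0 //; have := nsum_frob Sx; rewrite p2.
have [X1|X1] := boolP (1 \in X).
  have S21 : 1 \in nsumH 2 by case/setD1P: X1.
  have : 1 + 1 + 0 \in nsumH (2 + 1 + 2) by rewrite !nsumD ?nsum1.
  by rewrite addr0 -[1 + 1]/(2%:R) two0.
have XH x : x \in X -> x \notin H.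
  move=> Xx; apply: contra X1 => Hx.
  by rewrite -(mulVf (H_neq0 Hx)) sX ?HV.
have [g Xg] : exists g : K, g \in X.
  by apply/set0Pn; rewrite -card_gt0 c2 muln_gt0 M_gt0.
have g0 : g != 0 by case/setD1P: Xg.
have g20 : g ^+ 2 != 0 by rewrite expf_neq0.
pose C1 : {set K} := [set a * g | a in H]; pose C2 : {set K} := [set a * g ^+ 2 | a in H].
have disj : [disjoint C1 & C2].
  apply/pred0P => x /=; apply/negP => /andP[/imsetP[a Ha ->] /imsetP[b Hb E]].
  case/negP: (XH _ Xg); have -> : g = b^-1 * a.
    apply: (mulIf g0); rewrite -mulrA E mulKf ?H_neq0 //.
  by rewrite HM ?HV.
have EX : C1 :|: C2 = X.
  apply/eqP; rewrite eqEcard subUset (coset_sub sX Xg) (coset_sub sX (Xfrob _ Xg)).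
  by rewrite cardsU disjoint_setI0 // cards0 subn0 (card_coset g0) (card_coset g20) c2 mul2n addnn leqnn.
have H3 : g ^+ 3 \in H.
  have := Xfrob _ (Xfrob _ Xg); rewrite -EX inE => /orP[] /imsetP[a Ha E].
    have -> // : g ^+ 3 = a.
    by apply: (mulIf g0); rewrite -E -exprM -exprSr.
  case/negP: (XH _ (Xfrob _ Xg)).
  have -> // : g ^+ 2 = a by apply: (mulIf g20); rewrite -E -expr2.
(* [l = 2] would give [d * M = 3], against [4 < d]. Now [lmin] at 2 makes 3 coprime to [M], so cube
   roots exist in [H]. *)
have l2 : (2 < l)%N.
  rewrite ltn_neqAle l_gt1 andbT; apply: contraTneq d4 => E.
  rewrite -leqNgt -(leq_pmul2r M_gt0) dM -E p2.
  by rewrite (leq_trans (_ : _ <= 4 * 1)%N) // leq_pmul2l.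
have co3 : coprime 3 M by have := @lmin 2; rewrite p2 l2 => /(_ isT).
have [b Hb Eb] := root_H co3 isT (HV H3).
pose w := b * g; have Xw : w \in X by apply: sX.
have w3 : w ^+ 3 = 1 by rewrite exprMn Eb mulVf ?expf_neq0.
have w1 : w - 1 != 0 by rewrite subr_eq0; apply: contraNneq X1 => <-.
have <- : w + w ^+ 2 + 1 = 0.
  apply: (mulfI w1); rewrite mulr0.
  by transitivity (w ^+ 3 - 1); [ring | rewrite w3 subrr].
have [[_ Sw] [_ Sw2]] := (setD1P Xw, setD1P (Xfrob _ Xw)).
exact: nsumD (nsumD Sw Sw2) (nsum1 H1).
Qed.

(* Here [l = e * 2] and [3 * M = (2 ^ e - 1) * (2 ^ e + 1)], where the first
   factor is coprime to [M] by minimality of [l], hence divides 3. *)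
Let even_d3 : p = 2%N -> d = 3%N -> M = 5%N.
Proof.
move=> p2 d3; have := dM; rewrite d3 p2 => E.
have pe e : (0 < 2 ^ e)%N by rewrite expn_gt0.
have dvd3 : (3 %| 2 ^ l - 1)%N by rewrite -E dvdn_mulr.
have := @modn_expnB1 2 3 2 l isT isT; rewrite dvd3 => /esym.
rewrite modn2; case: (boolP (odd l)) => // l_even _.
pose e := l./2; have El : l = (e * 2)%N by rewrite muln2 even_halfK.
have e_gt0 : (0 < e)%N by move: l_gt1; rewrite El; case: (e).
have el : (e < l)%N by rewrite El -[X in (X < _)%N]muln1 ltn_pmul2l.
have co : coprime (2 ^ e - 1) M by rewrite -p2 lmin // e_gt0.
have : (2 ^ e - 1 %| 3)%N.
  rewrite -(Gauss_dvdl _ co) E El expnM.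
  by have -> := subn_sqr (2 ^ e) 1; rewrite dvdn_mulr.
rewrite dvdn_divisors // => e3.
have {e3} e2 : (2 ^ e <= 2 ^ 2)%N.
  by move: e3; rewrite !inE => /orP[] /eqP E'; rewrite -(subnK (pe e)) E'.
move: E; rewrite leq_exp2l // in e2.
(* [e = 1] gives [3 * M = 3], against [1 < M]; [e = 2] gives [3 * M = 15]. *)
rewrite El; case: (e) e_gt0 e2 => [|[|[|]]] // _ _ E.
  by move: M_gt1; rewrite -(ltn_pmul2l (isT : 0 < 3)%N) E.
by apply/eqP; rewrite -(eqn_pmul2l (isT : 0 < 3)%N) E.
Qed.

Lemma sum_roots_in_W_gt n : (d < n)%N -> in_W K M n.
Proof. by move/zero_gt/nsum_in_W. Qed.

Lemma sum_roots_in_W_ge n : ~ (d = (p - 1)%N \/ p = 2%N /\ d = 3%N /\ M = 5%N) ->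
  (d <= n)%N -> in_W K M n.
Proof.
move=> nsp dn; apply: nsum_in_W.
have dp : d <> (p - 1)%N by move=> E; apply: nsp; left.
have [w|w] := leqP (3 * M) #|nz (nsumH 2)|; first exact: zero_of_wide w dn.
have wide_d : (2 < d)%N -> #|nz (nsumH 2)| = (2 * M)%N by move=> d3; apply: card_nsum2.
have [p2|p_odd] := even_prime p_prime.
  have d_odd : odd d.
    have : odd (d * M) by rewrite dM p2 oddB ?expn_gt0 // oddX orbF (gtn_eqF (ltnW l_gt1)).
    by rewrite oddM => /andP[].
  (* [d] is odd; 1 is [p - 1], and 3 would force [M = 5], so both are special. *)
  have d4 : (4 < d)%N.
    move: nsp dp d_gt0 d_odd even_d3; rewrite p2; case: d => [|[|[|[|[|?]]]]] // nsp' _ _ _ M5.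
    by case: nsp'; right; rewrite M5.
  by apply: (even_case p2 d4 _ dn); apply/wide_d/ltnW/ltnW.
apply: odd_case => //; apply: wide_d; apply: leq_trans (mul2p1_le_d dp).
have p3 : (2 < p)%N.
  by rewrite ltn_neqAle prime_gt1 // andbT; apply: contraTneq p_odd => <-.
by rewrite (@leq_trans (2 * 2)) // leq_pmul2r // -(leq_add2r 1) subnK // prime_gt0.
Qed.

End SumsOfRootsOfUnity.

(** * Passage from [K] to the algebraic closure *)

Lemma closed_field_prim_root (F : closedFieldType) (n : nat) :
  (0 < n)%N -> n%:R != 0 :> F -> exists z : F, n.-primitive_root z.
Proof.
move=> n_gt0 nF0; have [s Es] := closed_field_poly_normal ('X^n - 1 : {poly F}).
rewrite lead_coefXnsubC // scale1r in Es.
have us : uniq s by rewrite -separable_prod_XsubC -Es separable_Xn_sub_1.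
suff /hasP[z _ hz] : has n.-primitive_root s by exists z.
apply: has_prim_root => //.
  apply/allP => x; rewrite -root_prod_XsubC -Es => /rootP.
  by move/eqP; rewrite !hornerE subr_eq0 unity_rootE.
by have := size_XnsubC (1 : F) n_gt0; rewrite Es size_prod_XsubC => -[->].
Qed.

Lemma in_W_rmorph (F E : fieldType) (f : {rmorphism F -> E}) (m n : nat) :
  in_W F m n -> in_W E m n.
Proof.
case=> alpha [aU aS]; exists (f \o alpha); split.
  by move=> i; rewrite /= -rmorphXn aU rmorph1.
by rewrite -rmorph_sum aS rmorph0.
Qed.

Lemma in_W_dvd (F : fieldType) (m m' n : nat) : (m' %| m)%N -> in_W F m' n -> in_W F m n.
Proof.
case/dvdnP => q -> [alpha [aU aS]]; exists alpha; split=> // i.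
by rewrite mulnC exprM aU expr1n.
Qed.

Theorem theorem5p6 (p m : nat)
    (hp : prime p) (hm : (3 <= m)%N)
    (hpm : gcdn p m = 1%N) (hp1m : gcdn (p - 1) m = 1%N)
    (Fbar : closedFieldType) (iota : {rmorphism 'F_p -> Fbar})
    (hFbar : algebraic_closure_of_Fp iota)
    (l : nat)
    (hl : is_minimum (fun e => (1 <= e)%N /\ (1 < gcdn (p ^ e - 1) m)%N) l)
    (K : finFieldType) (k : nat) (hK : #|K| = (p ^ k)%N)
    (jota : {rmorphism K -> Fbar})
    (hroots : forall x : Fbar, x ^+ m = 1 -> exists y : K, jota y = x) :
  let m' := gcdn (p ^ l - 1) m in
  let d' := ((p ^ l - 1) %/ m')%N in
  let d := ((p ^ k - 1) %/ m)%N in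
  let special := d' = (p - 1)%N \/ (p = 2%N /\ d' = 3%N /\ m' = 5%N) in
  (~ special ->
     (forall n : nat, (d' <= n)%N -> in_W Fbar m' n) /\
     (forall n : nat, (d <= n)%N -> in_W Fbar m n)) /\
  (special ->
     (forall n : nat, (d' + 1 <= n)%N -> in_W Fbar m' n) /\
     (forall n : nat, (d + 1 <= n)%N -> in_W Fbar m n)).
Proof.
move=> m' d' d special; have [[l_gt0 m'_gt1] lmin] := hl.
have p_gt0 := prime_gt0 hp; have m_gt0 : (0 < m)%N by apply: leq_trans hm.
have charK : p \in [pchar K] by apply: card_finPcharP hK hp.
have charF : p \in [pchar Fbar] by rewrite (fmorph_pchar jota).
have [z hz] : exists z : K, m.-primitive_root z.
  have [|x hx] := @closed_field_prim_root Fbar m m_gt0.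
    by rewrite -(dvdn_pcharf charF) -prime_coprime // /coprime hpm.
  have [y Ey] := hroots x (prim_expr_order hx).
  by exists y; rewrite -(fmorph_primitive_root jota) Ey.
have pe e : (0 < p ^ e)%N by rewrite expn_gt0 p_gt0.
have m_dvd : (m %| p ^ k - 1)%N.
  rewrite (prim_order_dvd hz) -hK; have z0 := prim_root_eq0 hz.
  rewrite -[_ == _](inj_eq (mulIf (_ : z != 0))) ?z0 ?gtn_eqF //.
  by rewrite -exprSr subn1 prednK ?mul1r ?expf_card // hK.
have m'_dvd : (m' %| p ^ l - 1)%N := dvdn_gcdl _ _.
have m'_m : (m' %| m)%N := dvdn_gcdr _ _.
have l_min e : (0 < e < l)%N -> coprime (p ^ e - 1) m.
  case/andP=> e_gt0 el; rewrite /coprime eqn_leq gcdn_gt0 m_gt0 orbT andbT leqNgt.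
  by apply/negP => ge; have := lmin e (conj e_gt0 ge); rewrite leqNgt el.
have l_gt1 : (1 < l)%N.
  rewrite ltn_neqAle l_gt0 andbT; apply: contraTneq m'_gt1 => <-.
  by rewrite expn1 hp1m.
(* [m'] divides [p ^ r - 1] for the remainder [r] of [k] modulo [l]; a positive [r] would contradict
   the minimality of [l]. *)
have l_k : (l %| k)%N.
  have := @modn_expnB1 p m' l k p_gt0 m'_dvd; rewrite (dvdn_trans m'_m m_dvd) => /esym dvd.
  rewrite /dvdn; case: posnP => // r_gt0.
  have := l_min (k %% l)%N; rewrite r_gt0 ltn_mod l_gt0 => /(_ isT) /(coprime_dvdr m'_m).
  by rewrite /coprime (gcdn_idPr dvd) gtn_eqF.
have d'_le_d : (d' <= d)%N.
  have m'_gt0 := ltnW m'_gt1.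
  rewrite leq_divRL // dvdn_leq ?subn_gt0 //.
    rewrite -(exp1n k) ltn_exp2r ?prime_gt1 //.
    by rewrite lt0n; apply: contraTneq (finRing_gt1 K) => k0; rewrite hK k0.
  have -> : (d' * m = lcmn (p ^ l - 1) m)%N by rewrite /lcmn -/m' -divn_mulAC.
  rewrite dvdn_lcm m_dvd andbT; have /dvdnP[q ->] := l_k.
  by rewrite mulnC expnM; have := subn_exp (p ^ l) 1 q; rewrite exp1n => ->; apply: dvdn_mulr.
have hz' : m'.-primitive_root (z ^+ (m %/ m')) by apply: dvdn_prim_root.
have W := in_W_rmorph jota; have U n := @in_W_dvd Fbar m m' n m'_m.
have cop e (el : (0 < e < l)%N) := coprime_dvdr m'_m (l_min e el).
have gt n (dn : (d' + 1 <= n)%N) : in_W Fbar m' n.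
  by apply: W; apply: (sum_roots_in_W_gt charK hz' m'_gt1 l_gt1 m'_dvd cop); rewrite -addn1.
have ge (ns : ~ special) n (dn : (d' <= n)%N) : in_W Fbar m' n.
  by apply: W; apply: (sum_roots_in_W_ge charK hz' m'_gt1 l_gt1 m'_dvd cop).
split=> sp; split=> n dn.
- exact: ge.
- by apply/U/ge => //; apply: leq_trans dn.
- exact: gt.
- by apply/U/gt; apply: leq_trans dn; rewrite leq_add2r.
Qed.
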